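(* Let $\epsilon>0$. Every graph $G=(V,E)$ on $n$ vertices has an edge partition $E=E_0\cup E_1\cup\cdots\cup E_\ell$ such that $|E_0|\le \epsilon n^2$, $\ell\le 16\epsilon^{-1}$, and for $1\le i\le \ell$ the diameter of $E_i$ is at most $4$.
   Context: Graphs are finite and simple. The diameter of a connected graph is the maximum distance between two vertices ($\infty$ if disconnected). The diameter of an edge set $E'$ is the diameter of the graph with edge set $E'$ on the vertices covered by $E'$. *)

(* Defs.v *)
From mathcomp Require Import all_boot all_order all_algebra.
From mathcomp Require Import reals.

Set Implicit Arguments.
Unset Strict Implicit.
Unset Printing Implicit Defensive.

(* A finite simple graph with vertex type V is given by its edge set, a set of
   two-element subsets of V; isolated vertices are allowed. *)
Definition simple_graph (V : finType) (E : {set {set V}}) : Prop :=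
  forall e : {set V}, e \in E -> #|e| = 2.

Definition adj (V : finType) (F : {set {set V}}) : rel V :=
  [rel x y | [set x; y] \in F].

Definition walk (V : finType) (F : {set {set V}}) (x y : V) (k : nat) : bool :=
  [exists p : k.-tuple V, path (adj F) x p && (last x p == y)].

Lemma connect_walk (V : finType) (F : {set {set V}}) (x y : V) :
  connect (adj F) x y -> exists k, walk F x y k.
Proof.
move=> /connectP[p Fp ->]; exists (size p); apply/existsP.
by exists (in_tuple p); rewrite Fp eqxx.
Qed.

(* Extended natural numbers: None stands for infinity. *)
Definition omax (a b : option nat) : option nat :=
  if a is Some m then if b is Some n then Some (maxn m n) else None else None.

Definition dist (V : finType) (F : {set {set V}}) (x y : V) : option nat :=
  match @idP (connect (adj F) x y) with
  | ReflectT xy => Some (ex_minn (connect_walk xy))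
  | ReflectF _ => None
  end.

(* Only the vertices covered by F count. A walk along F between covered
   vertices visits covered vertices only, so dist F is the distance in the
   graph (cover F, F). The value on the empty edge set is Some 0. *)
Definition diameter (V : finType) (F : {set {set V}}) : option nat :=
  \big[omax/Some 0]_(x in cover F) \big[omax/Some 0]_(y in cover F) dist F x y.

Definition edge_partition (V : finType) (E : {set {set V}}) (l : nat)
    (P : 'I_l -> {set {set V}}) : Prop :=
  E = \bigcup_(i < l) P i /\
  (forall i j : 'I_l, i != j -> [disjoint P i & P j]).

(* Main.v *)
Require Import Defs.
From mathcomp Require Import all_boot all_order all_algebra.
From mathcomp Require Import reals.
Import Order.TTheory GRing.Theory Num.Theory.
Local Open Scope ring_scope.

(** As long as some vertex [v] has degree exceeding [eps * n] in the current
    graph, remove as one class all edges meeting its neighbourhood [N(v)]. Every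
    vertex covered by this class is within distance 2 of [v], so the class has
    diameter at most 4. All of [N(v)] becomes isolated, so more than [eps * n]
    vertices are used up in each round and there are at most [1 / eps] rounds.
    In the end all degrees are at most [eps * n], leaving at most [eps * n ^ 2]
    edges for [E_0]. *)

Section Greedy.
Local Open Scope nat_scope.
Set Implicit Arguments.
Unset Strict Implicit.
Context {V : finType}.
Implicit Types (F : {set {set V}}) (x y v : V).

Definition neighbours F v : {set V} := [set u | adj F v u].

Definition neighbourhood_edges F v : {set {set V}} :=
  [set e in F | ~~ [disjoint e & neighbours F v]].

Lemma adjC F x y : adj F x y = adj F y x.
Proof. by rewrite /adj /= setUC. Qed.

Lemma simple_graph_sub F F' :
  F' \subset F -> simple_graph F -> simple_graph F'.
Proof. by move=> /subsetP sF hF e /sF /hF. Qed.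

Lemma simple_edgeP F e x u :
  simple_graph F -> e \in F -> x \in e -> u \in e -> x != u ->
  e = [set x; u].
Proof.
move=> hF eF xe ue xu; apply/esym/eqP; rewrite eqEcard cards2 xu (hF _ eF).
by rewrite subUset !sub1set xe ue.
Qed.

Lemma dist_path_le F x y p :
  path (adj F) x p -> last x p = y ->
  exists2 d, dist F x y = Some d & d <= size p.
Proof.
move=> Fp pE; have Fw : walk F x y (size p).
  by apply/existsP; exists (in_tuple p); rewrite /= Fp pE eqxx.
have xy : connect (adj F) x y by apply/connectP; exists p.
(* Destructing the reflection proof makes the match inside [dist] reduce. The minimality of
   [ex_minn] then bounds the distance by the walk of length [size p]. *)
rewrite /dist; destruct (@idP (connect (adj F) x y)) as [c|] => //.
by eexists; [reflexivity | case: ex_minnP => m _; apply].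
Qed.

Lemma diameter_le F k :
  (forall x y, x \in cover F -> y \in cover F ->
     exists2 d, dist F x y = Some d & d <= k) ->
  exists2 d, diameter F = Some d & d <= k.
Proof.
move=> Fk; pose K o := exists2 d, o = Some d & d <= k.
have K0 : K (Some 0) by exists 0.
have Kmax a b : K a -> K b -> K (omax a b).
  move=> [m -> mk] [n -> nk]; exists (maxn m n) => //.
  by rewrite geq_max mk.
rewrite -/(K _) /diameter; apply: (big_ind K) => // x xF.
by apply: (big_ind K) => // y yF; apply: Fk.
Qed.

(** Walk from [x] back to [v] and on to [y], in at most 2 + 2 steps. Since [adj] is symmetric,
    [rev (belast v p)] serves as the first half. *)
Lemma diameter_radius2 F v :
  (forall x, x \in cover F -> exists p,
     [/\ path (adj F) v p, last v p = x & size p <= 2]) ->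
  exists2 d, diameter F = Some d & d <= 4.
Proof.
move=> Fv; apply: diameter_le => x y /Fv[p [Fp px sp]] /Fv[q [Fq qy sq]].
have [d -> dle] : exists2 d, dist F x y = Some d
    & d <= size (rev (belast v p) ++ q).
  apply: dist_path_le.
    rewrite cat_path -{1}px rev_path.
    rewrite (eq_path (e' := adj F)) ?Fp => [|a b]; last exact: adjC.
    suff -> : last x (rev (belast v p)) = v by [].
    by case: p px {Fp sp} => //= a p _; rewrite rev_cons last_rcons.
  suff lE : last x (rev (belast v p)) = v by rewrite last_cat lE.
  by case: p px {Fp sp} => //= a p _; rewrite rev_cons last_rcons.
exists d => //; apply: leq_trans dle _.
by rewrite size_cat size_rev size_belast (leq_add sp sq).
Qed.

Lemma adj_neighbourhood F v u :
  u \in neighbours F v -> adj (neighbourhood_edges F v) v u.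
Proof.
move=> uN; have vuF : [set v; u] \in F by move: uN; rewrite inE.
rewrite /adj /= inE vuF; apply/pred0Pn; exists u.
by rewrite /= uN !inE eqxx orbT.
Qed.

(** An edge [e] of the class contains some [u] in [N(v)]. The edge from [v] to [u] meets [N(v)] in
    [u], so it lies in the class too, and [v], [u], [x] is a walk inside the class for any [x] in
    [e]. *)
Lemma neighbourhood_edges_diameter F v :
  simple_graph F ->
  exists2 d, diameter (neighbourhood_edges F v) = Some d & d <= 4.
Proof.
move=> hF; apply: (@diameter_radius2 _ v) => x /bigcupP[e].
rewrite inE => /andP[eF meets] xe.
have [u ue uN] : exists2 u, u \in e & u \in neighbours F v.
  by move: meets => /pred0Pn[u /andP[ue uN]]; exists u.
have vu := adj_neighbourhood uN.
have [xu|xu] := eqVneq x u; first by exists [:: u]; rewrite /= vu xu.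
exists [:: u; x]; split=> //=; rewrite vu /= andbT /adj /=.
rewrite -(simple_edgeP hF eF ue xe) 1?eq_sym // inE eF.
exact: meets.
Qed.

Lemma neighbours_cover F v : neighbours F v \subset cover F.
Proof.
apply/subsetP => u; rewrite inE => vu.
by apply/bigcupP; exists [set v; u] => //; rewrite !inE eqxx orbT.
Qed.

(** No surviving edge touches [N(v)], so [N(v)] and the remaining cover are disjoint subsets of the
    old cover. This inequality pays for each round. *)
Lemma cover_remaining F v :
  #|cover (F :\: neighbourhood_edges F v)| + #|neighbours F v|
    <= #|cover F|.
Proof.
have dis : [disjoint cover (F :\: neighbourhood_edges F v)
                   & neighbours F v].
  rewrite disjoint_sym; apply/bigcup_disjointP => e.
  rewrite !inE negb_and negbK => /andP[/orP[/negP //|dis] _].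
  by rewrite disjoint_sym.
have [_] := leq_card_setU (cover (F :\: neighbourhood_edges F v))
  (neighbours F v); rewrite dis => /eqP <-.
apply: subset_leq_card; rewrite subUset neighbours_cover andbT.
apply/bigcupsP => e; rewrite inE => /andP[_ eF].
exact: (bigcup_sup e).
Qed.

(** Charge each edge to one of its endpoints; a vertex is charged at most its degree. *)
Lemma card_edges_le F t :
  simple_graph F -> (forall v, #|neighbours F v| <= t) ->
  #|F| <= t * #|V|.
Proof.
move=> hF Ft.
have sF : F \subset \bigcup_v [set [set v; u] | u in neighbours F v].
  apply/subsetP => e eF; have /eqP/cards2P[x [y [_ eE]]] := hF e eF.
  apply/bigcupP; exists x => //; apply/imsetP; exists y => //.
  by rewrite inE /adj /= -eE.
apply: leq_trans (subset_leq_card sF) _.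
rewrite mulnC -sum_nat_const.
apply: (big_ind2 (fun (A : {set {set V}}) k => #|A| <= k)).
- by rewrite cards0.
- move=> A a B b Aa Bb.
  exact: leq_trans (leq_card_setU A B) (leq_add Aa Bb).
- by move=> v _; apply: leq_trans (leq_imset_card _ _) (Ft v).
Qed.

(** The greedy procedure with an integer degree threshold [t]: each round uses up at least [t.+1]
    covered vertices, hence the bound on [l]. The induction is on the number of covered vertices,
    and index [ord0] holds the leftover edges. *)
Lemma greedy_decomposition t F :
  simple_graph F ->
  exists (l : nat) (P : 'I_l.+1 -> {set {set V}}),
    [/\ edge_partition F P,
        #|P ord0| <= t * #|V|,
        l * t.+1 <= #|cover F|
      & forall i : 'I_l.+1, i != ord0 ->
          P i != set0 /\
          exists2 d, diameter (P i) = Some d & d <= 4].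
Proof.
have [m] := ubnP #|cover F|; elim: m F => // m IHm F Fm hF.
have [/forallP Ft|] := boolP [forall v, #|neighbours F v| <= t].
  exists 0, (fun=> F); split=> [||//|i]; last by rewrite ord1.
  - by split=> [|i j]; rewrite ?big_ord1 // !ord1.
  - exact: card_edges_le.
rewrite negb_forall => /existsP[v]; rewrite -ltnNge => vt.
set C := neighbourhood_edges F v; pose F' := F :\: C.
have CF : C \subset F by apply/subsetP => e; rewrite inE => /andP[].
have cF' := cover_remaining F v; rewrite -/C -/F' in cF'.
have hF' : simple_graph F' := simple_graph_sub (subsetDl F C) hF.
have F'm : #|cover F'| < m.
  apply: leq_trans (_ : #|cover F| <= m); last by [].
  apply: leq_trans cF'; rewrite -addn1 leq_add2l.
  exact: leq_ltn_trans vt.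
have [l [P [[PF' Pdis] P0 lP Pdiam]]] := IHm F' F'm hF'.
have C0 : C != set0.
  have /card_gt0P[u uN] : 0 < #|neighbours F v| by apply: leq_ltn_trans vt.
  by apply/set0Pn; exists [set v; u]; apply: adj_neighbourhood uN.
have PC i : [disjoint P i & C].
  have sP : P i \subset F' by rewrite PF' (bigcup_sup i).
  apply: disjointWl sP _; rewrite disjoint_subset.
  by apply/subsetP => e /setDP[].
(* The new class goes to the last index, so the leftover set keeps index [ord0]. *)
pose P' (i : 'I_l.+2) := if unlift ord_max i is Some j then P j else C.
have P'0 : P' ord0 = P ord0.
  by rewrite (_ : ord0 = lift ord_max ord0) /P' ?liftK //; apply: val_inj.
exists l.+1, P'; split.
- split=> [|i j].
    rewrite big_ord_recr /= {2}/P' unlift_none.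
    have -> : \bigcup_(i < l.+1) P' (widen_ord (leqnSn l.+1) i) = F'.
      rewrite PF'; apply: eq_bigr => i _; rewrite /P'.
      rewrite (_ : widen_ord _ i = lift ord_max i) ?liftK //.
      by apply: val_inj; rewrite /= /bump leqNgt ltn_ord.
    by rewrite setUC -{1}(setID F C) (setIidPr CF).
  rewrite /P'; case: unliftP => [i' ->|->]; case: unliftP => [j' ->|->].
  + by rewrite (inj_eq lift_inj); apply: Pdis.
  + by move=> _; apply: PC.
  + by move=> _; rewrite disjoint_sym; apply: PC.
  + by rewrite eqxx.
- by rewrite P'0.
- by rewrite mulSn addnC; apply: leq_trans cF'; apply: leq_add.
- move=> i; rewrite /P'; case: unliftP => [j ->|-> _].
    move=> j0; apply: Pdiam; apply: contraNneq j0 => ->.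
    by apply/eqP/val_inj.
  by split=> //; apply: neighbourhood_edges_diameter.
Qed.

End Greedy.

Theorem theorem2p14 (R : realType) (eps : R) (heps : 0 < eps)
    (V : finType) (E : {set {set V}}) (hE : simple_graph E) :
  exists (l : nat) (P : 'I_l.+1 -> {set {set V}}),
    [/\ edge_partition E P,
        #|P ord0|%:R <= eps * #|V|%:R ^+ 2,
        l%:R <= 16 * eps^-1
      & forall i : 'I_l.+1, i != ord0 ->
          P i != set0 /\ (exists2 d : nat, diameter (P i) = Some d & (d <= 4)%N)].
Proof.
have n_ge0 : 0 <= eps * #|V|%:R by rewrite mulr_ge0 ?(ltW heps).
have /andP[tle tgt] := truncn_itv n_ge0.
(* With [t] the integer part of [eps * n], the bound [t <= eps * n] controls the leftover edges, and
   [eps * n < t + 1] controls the number of classes. *)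
set t := Num.truncn _ in tle tgt.
have [l [P [PE P0 lP Pdiam]]] := greedy_decomposition t hE.
exists l, P; split=> //.
  apply: le_trans (_ : (t * #|V|)%:R <= _); first by rewrite ler_nat.
  by rewrite natrM expr2 mulrA ler_wpM2r.
have ltn : (l * t.+1 <= #|V|)%N := leq_trans lP (max_card _).
(* The main estimate cancels [n], so [n = 0] is treated apart; there [l = 0]. *)
have [V0|V_gt0] := posnP #|V|.
  move: ltn; rewrite V0 leqn0 muln_eq0 orbF => /eqP->.
  by rewrite mulr_ge0 // invr_ge0 ltW.
(* The sharper bound [l <= eps^-1] holds, because [l * eps * n <= l * (t + 1) <= n]. *)
apply: le_trans (_ : eps^-1 <= _); last first.
  by rewrite ler_peMl ?invr_ge0 ?(ltW heps) // ler1n.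
rewrite -[eps^-1]mul1r ler_pdivlMr // -(ler_pM2r (_ : 0 < #|V|%:R)) ?ltr0n //.
rewrite mul1r -mulrA; apply: le_trans (_ : (l * t.+1)%:R <= _).
  by rewrite natrM ler_wpM2l // ltW.
by rewrite ler_nat.
Qed.
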